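(* Let $\eta>0$ and let $m,d$ be positive integers. Then there exists a positive integer $n_3=n_3(\eta,m,d)$ such that for every integer $n\geq n_3$ and every $d$-integer polynomial $Q\colon\mathbb{F}_2^{\binom{[n]}{\leq 2}}\to\mathbb{Z}_{2^d}$ of degree at most $d$, there exists a collection $\mathcal{V}$ of pairwise disjoint $m$-dimensional block HJ-subspaces of $\mathbb{F}_2^{\binom{[n]}{\leq 2}}$ such that (i) $\mathbb{P}\big[\mathbb{F}_2^{\binom{[n]}{\leq 2}}\setminus\bigcup\mathcal{V}\big]\leq\eta$, and (ii) for every $V\in\mathcal{V}$, $Q$ is constant on $V$.
   Context: $\binom{[n]}{\leq 2}$ is the set of nonempty subsets of $[n]$ with at most two elements; $\mathbb{P}$ is the uniform probability measure on $\mathbb{F}_2^{\binom{[n]}{\leq 2}}$; $\mathbb{Z}_{2^k}=\mathbb{Z}/2^k\mathbb{Z}$. Integer polynomial: a function $Q\colon\mathbb{F}_2^{\binom{[n]}{\leq 2}}\to\mathbb{Z}_{2^k}$ is a $k$-integer polynomial of degree at most $d$ if $Q(x)=\alpha+\sum_{F}\lambda_F\prod_{e\in F}x(e)\bmod 2^k$, the sum over nonempty $F\subseteq\binom{[n]}{\leq 2}$ with $|F|\leq d$, with $\alpha,\lambda_F\in\mathbb{Z}_{2^k}$ and $x(e)\in\{0,1\}\subseteq\mathbb{Z}_{2^k}$. HJ-subspaces: let $n\geq m\geq 1$ and let $\boldsymbol{I}=(I_1,\dots,I_m)$ be pairwise disjoint nonempty subsets of $[n]$ with $\min I_1<\dots<\min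 I_m$. For $q\in\binom{[m]}{\leq 2}$ let $b_q\in\mathbb{F}_2^{\binom{[n]}{\leq 2}}$ be the indicator of $\{p\in\binom{[n]}{\leq 2}: p\subseteq\bigcup_{i\in q}I_i \text{ and } p\cap I_i\neq\emptyset\ \forall i\in q\}$, and $\mathrm{Id}_{\boldsymbol I}(x)=\sum_{q}x(q)b_q$ for $x\in\mathbb{F}_2^{\binom{[m]}{\leq 2}}$. An HJ-embedding is a map $e=\mathrm{Id}_{\boldsymbol I}+c$ where $c\in\mathbb{F}_2^{\binom{[n]}{\leq 2}}$ vanishes on $\binom{I_1\cup\dots\cup I_m}{\leq 2}$; its image is an HJ-subspace of dimension $m$ with wildcard sets $\boldsymbol I$. It is block if $\max I_i<\min I_{i+1}$ for all $i<m$. *)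

(* Defs.v *)
From HB Require Import structures.
From mathcomp Require Import all_boot all_order all_algebra.
From mathcomp Require Import reals.
Set Implicit Arguments. Unset Strict Implicit. Unset Printing Implicit Defensive.
Import Order.TTheory GRing.Theory Num.Theory.
Local Open Scope ring_scope.

Definition Idx (n : nat) := {A : {set 'I_n} | (0 < #|A|)%N && (#|A| <= 2)%N}.

Definition points (n : nat) := {ffun Idx n -> 'F_2}.

Definition prob {R : realType} (n : nat) (S : {set points n}) : R :=
  (#|S|%:R) / (#|{: points n}|%:R).

Definition lift01 (k : nat) (b : 'F_2) : 'Z_(2 ^ k) := (nat_of_ord b)%:R.

Definition is_int_poly (n k d : nat) (Q : points n -> 'Z_(2 ^ k)) : Prop :=
  exists (alpha : 'Z_(2 ^ k)) (lambda : {set Idx n} -> 'Z_(2 ^ k)),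
    forall x : points n,
      Q x = alpha + \sum_(F : {set Idx n} | (0 < #|F|)%N && (#|F| <= d)%N)
                      lambda F * \prod_(e in F) lift01 k (x e).

Definition smin (n : nat) (A : {set 'I_n}) : nat := \big[minn/n]_(j in A) (nat_of_ord j).
Definition smax (n : nat) (A : {set 'I_n}) : nat := \max_(j in A) (nat_of_ord j).

Definition wildcards (n m : nat) (I : 'I_m -> {set 'I_n}) : Prop :=
  (forall i, I i != set0) /\
  (forall i j, i != j -> [disjoint I i & I j]) /\
  (forall i j : 'I_m, (i < j)%N -> (smin (I i) < smin (I j))%N).

Definition block_wildcards (n m : nat) (I : 'I_m -> {set 'I_n}) : Prop :=
  wildcards I /\ (forall i j : 'I_m, (i < j)%N -> (smax (I i) < smin (I j))%N).

Definition wunion (n m : nat) (I : 'I_m -> {set 'I_n}) : {set 'I_n} :=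
  \bigcup_(i : 'I_m) I i.

Definition bq (n m : nat) (I : 'I_m -> {set 'I_n}) (q : Idx m) : points n :=
  [ffun p : Idx n =>
     if (val p \subset \bigcup_(i in val q) I i) &&
        [forall i in val q, val p :&: I i != set0]
     then 1 else 0].

Definition IdI (n m : nat) (I : 'I_m -> {set 'I_n}) (x : points m) : points n :=
  [ffun p : Idx n => \sum_(q : Idx m) x q * bq I q p].

Definition HJ_embedding (n m : nat) (I : 'I_m -> {set 'I_n}) (c : points n)
  (x : points m) : points n :=
  [ffun p : Idx n => IdI I x p + c p].

Definition c_admissible (n m : nat) (I : 'I_m -> {set 'I_n}) (c : points n) : Prop :=
  forall p : Idx n, val p \subset wunion I -> c p = 0.

Definition block_HJ_subspace (n m : nat) (V : {set points n}) : Prop :=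
  exists (I : 'I_m -> {set 'I_n}) (c : points n),
    block_wildcards I /\ c_admissible I c /\
    V = [set HJ_embedding I c x | x : points m].

(* Main.v *)
Require Import Defs.
From HB Require Import structures.
From mathcomp Require Import all_boot all_order all_algebra.
From mathcomp Require Import reals.
From mathcomp Require Import fingroup cyclic ring lra.
Import Order.TTheory GRing.Theory Num.Theory.
Local Open Scope ring_scope.
Set Implicit Arguments. Unset Strict Implicit. Unset Printing Implicit Defensive.

(** The values may lie in any finite abelian group [A]; this allows finitely
    many polynomials to be treated as one.

    In some fixed dimension [N] every polynomial is constant on an
    [m]-dimensional block subspace: by Ramsey's theorem pass to a large set of
    vertices on which the coefficient of a monomial depends only on the order
    type of the monomial, and cut that set into consecutive blocks of size
    [w = |A| * (2d)!]. Grouping the monomials by the labels of the blocks they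
    meet, each group has size a product of binomials ['C(w, a)], all divisible
    by [|A|] as soon as some [a > 0], so only the constant term survives.

    The packing is by induction on the degree. Split the vertices into the
    first [N] and the remaining ones, and fix the coordinates of the crossing
    edges at [z]. The differences [f (a, z, y) - f (0, z, y)] have smaller
    degree in [y], so the [y]-space is almost covered by large subspaces [W] on
    which all of them are constant. Then one [m]-dimensional [V] works for all
    [y] in [W]: use the cells [V * {z} * {y}], and treat the sets
    [{a} * {z} * W] with [a] outside [V] recursively. Each round multiplies the
    uncovered proportion by at most [1 - 1 / |points N|], up to a negligible
    error. *)

(** * Ramsey's theorem and sums over subsequences *)

Lemma pigeonhole_seq (C : finType) (T : Type) (g : T -> C) (M : nat) (t : seq T) :
  (#|C| * M < size t)%N -> exists c, (M < count (fun x => g x == c) t)%N.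
Proof.
move=> lt_t; apply/existsP; rewrite -[[exists _, _]]negbK negb_exists.
apply: contraL lt_t => /forallP le_M; rewrite -leqNgt.
have -> : size t = (\sum_(c : C) count (fun x => g x == c) t)%N.
  rewrite -sum1_size (partition_big g predT) //=.
  by apply: eq_bigr => c _; rewrite -sum1_count.
rewrite -sum_nat_const; apply: leq_sum => c _.
by rewrite leqNgt; apply: le_M.
Qed.

(** Induction on [k]. A long sequence is thinned until the colour of a subsequence of size [k.+1]
    depends on its first element alone; by pigeonhole, more than [M] elements then prescribe the
    same colour. *)
Lemma ramsey (C : finType) (k M : nat) : exists N : nat,
  forall (T : eqType) (s : seq T) (f : seq T -> C), (N <= size s)%N ->
  exists t, [/\ subseq t s, size t = M &
    forall u v, subseq u t -> subseq v t -> size u = k -> size v = k -> f u = f v].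
Proof.
elim: k M => [|k IHk] M.
  exists M => T s f le_s; exists (take M s); split; first exact: take_subseq.
    by rewrite size_takel.
  by move=> u v _ _ /size0nil-> /size0nil->.
have [N HN] : exists N : nat, forall (T : eqType) (s : seq T) (f : seq T -> C),
    (N <= size s)%N -> exists t (g : T -> C), [/\ subseq t s,
      size t = (#|C| * M).+1 &
      forall x u, subseq (x :: u) t -> size u = k -> f (x :: u) = g x].
  elim: (#|C| * M).+1 => [|L [N IHL]].
    by exists 0%N => T s f _; exists [::], (fun=> f [::]); rewrite sub0seq.
  (* The [k] spare elements ensure that [t1] has a subsequence of size [k], from which the colour
     attached to [x] is read. *)
  have [N' HN'] := IHk (N + k)%N; exists N'.+1 => T [|x s] f // le_s.
  have [t1 [t1s t1N t1f]] := HN' T s (fun u => f (x :: u)) le_s.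
  have [|t2 [g [t2t1 t2L t2g]]] := IHL T t1 f; first by rewrite t1N leq_addr.
  exists (x :: t2), (fun y => if y == x then f (x :: take k t1) else g y); split.
  - by rewrite /= eqxx (subseq_trans t2t1 t1s).
  - by rewrite /= t2L.
  move=> y u /=; case: eqP => [-> ut2 uk|_]; last exact: t2g.
  apply: t1f; rewrite ?take_subseq ?size_takel ?t1N ?leq_addl //.
  exact: subseq_trans ut2 t2t1.
exists N => T s f /(HN T s f)[t [g [ts tL tg]]].
have [|c ltM] := @pigeonhole_seq C T g M t; first by rewrite tL.
set t' := filter (fun x => g x == c) t.
have t't : subseq t' t by exact: filter_subseq.
have fc u : subseq u (take M t') -> size u = k.+1 -> f u = c.
  case: u => // x u ut [uk].
  have ut' := subseq_trans ut (take_subseq t' M).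
  rewrite (tg x u) ?(subseq_trans ut' t't) //.
  have: x \in t' by apply: (mem_subseq ut'); rewrite mem_head.
  by rewrite mem_filter => /andP[/eqP].
exists (take M t'); split.
- exact: subseq_trans (take_subseq _ _) (subseq_trans t't ts).
- by rewrite size_takel // size_filter ltnW.
by move=> u v ut vt uk vk; rewrite !fc.
Qed.

(** One application of [ramsey] per positive size up to [D], each inside the sequence found before;
    homogeneity passes to subsequences. *)
Lemma ramsey_le (C : finType) (D M : nat) : exists N : nat,
  forall (T : eqType) (s : seq T) (f : seq T -> C), (N <= size s)%N ->
  exists t, [/\ subseq t s, size t = M & forall u v,
    subseq u t -> subseq v t -> size u = size v -> (size u <= D)%N -> f u = f v].
Proof.
elim: D M => [|D IHD] M.
  exists M => T s f le_s; exists (take M s).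
  rewrite take_subseq size_takel //; split=> // -[|??] [|??] //.
have [N HN] := ramsey C D.+1 M; have [N' HN'] := IHD N.
exists N' => T s f /(HN' T s f)[t1 [t1s t1N t1f]].
have [|t2 [t2t1 t2M t2f]] := HN T t1 f; first by rewrite t1N.
exists t2; split=> // [|u v ut vt uv]; first exact: subseq_trans t1s.
rewrite leq_eqVlt => /orP[/eqP uD|]; first by apply: t2f => //; rewrite -uv.
by apply: t1f; rewrite ?(subseq_trans _ t2t1).
Qed.

Fixpoint subseqs (T : Type) (s : seq T) : seq (seq T) :=
  if s is x :: s' then map (cons x) (subseqs s') ++ subseqs s' else [:: [::]].

Lemma subseqs_subseq (T : eqType) (s t : seq T) : t \in subseqs s -> subseq t s.
Proof.
elim: s t => [|x s IHs] t /=; first by rewrite inE => /eqP->.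
rewrite mem_cat => /orP[/mapP[u /IHs us ->]|/IHs ts]; first by rewrite /= eqxx.
exact: subseq_trans ts (subseq_cons s x).
Qed.

Lemma subseqs_map (T U : Type) (b : T -> U) (s : seq T) :
  subseqs (map b s) = map (map b) (subseqs s).
Proof. by elim: s => //= x s ->; rewrite map_cat -!map_comp. Qed.

Section SubseqSums.
Variable A : zmodType.

Lemma big_subseqs_cat (T : Type) (s1 s2 : seq T) (h : seq T -> A) :
  \sum_(t <- subseqs (s1 ++ s2)) h t =
  \sum_(t1 <- subseqs s1) \sum_(t2 <- subseqs s2) h (t1 ++ t2).
Proof.
elim: s1 h => [|x s1 IHs] h /=; first by rewrite big_seq1.
by rewrite !big_cat !big_map /= !IHs.
Qed.

Lemma big_subseqs_nseq (T : Type) (n : nat) (i : T) (h : seq T -> A) :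
  \sum_(t <- subseqs (nseq n i)) h t = \sum_(a < n.+1) h (nseq a i) *+ 'C(n, a).
Proof.
elim: n h => [|n IHn] h /=.
  by rewrite big_seq1 big_ord_recl big_ord0 /= addr0 bin0 mulr1n.
rewrite big_cat big_map /= !IHn [RHS]big_ord_recl /=.
under [X in _ = _ + X]eq_bigr => a _ do rewrite /bump /= add1n binS mulrnDr.
rewrite big_split /= [RHS]addrA [RHS]addrC; congr (_ + _).
rewrite [in LHS]big_ord_recl /= !bin0; congr (_ + _).
by rewrite [in RHS]big_ord_recr /= bin_small // mulr0n addr0.
Qed.

(** Peel off the last block: a subsequence takes [a] of its [w] equal labels in ['C(w, a)] ways. For
    [0 < a <= D] this binomial kills the term; for [a > D] the sequence is too long for [h]. *)
Lemma big_subseqs_blocks (h : seq nat -> A) (D w m : nat) :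
  (forall t, (D < size t)%N -> h t = 0) ->
  (forall a (y : A), (0 < a <= D)%N -> y *+ 'C(w, a) = 0) ->
  \sum_(t <- subseqs [seq (j %/ w)%N | j <- iota 0 (m * w)]) h t = h [::].
Proof.
move=> hD Cw; elim: m => [|m IHm]; first by rewrite mul0n big_seq1.
have [w0|w_gt0] := posnP w; first by rewrite w0 muln0 big_seq1.
rewrite mulSn addnC iotaD map_cat add0n big_subseqs_cat -[RHS]IHm.
have -> : [seq (j %/ w)%N | j <- iota (m * w) w] = nseq w m.
  apply: (@eq_from_nth _ 0%N); rewrite size_map size_iota ?size_nseq // => i lt_i.
  by rewrite (nth_map 0%N) ?size_iota // nth_iota // nth_nseq lt_i divnMDl // divn_small ?addn0.
apply: eq_bigr => t _; rewrite big_subseqs_nseq big_ord_recl /= bin0 cats0 mulr1n.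
rewrite big1 ?addr0 // => a _; have [le_a|lt_a] := leqP a.+1 D; first by rewrite Cw.
by rewrite hD ?mul0rn // size_cat /= size_nseq (leq_trans lt_a) ?leq_addl.
Qed.

Lemma big_subsets_subseqs (T : finType) (s : seq T) (g : {set T} -> A) :
  uniq s -> \sum_(S : {set T} | S \subset [set x in s]) g S =
            \sum_(t <- subseqs s) g [set x in t].
Proof.
elim: s g => [|x s IHs] g /=.
  have -> : [set x in [::]] = set0 :> {set T} by apply/setP => x; rewrite !inE.
  by rewrite (eq_bigl (pred1 set0)) ?big_pred1_eq ?big_seq1 // => S; rewrite subset0.
case/andP=> xs us; rewrite big_cat big_map /= -IHs //.
under [X in X + _]eq_bigr => t _ do rewrite set_cons.
rewrite -(IHs (fun S => g (x |: S))) // (bigID (fun S : {set T} => x \in S)) /=.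
have xB (S : {set T}) : S \subset [set y in s] -> x \notin S.
  by move=> sS; apply: contra xs => /(subsetP sS); rewrite inE.
congr (_ + _).
  rewrite (reindex_onto (fun S => x |: S) (fun S => S :\ x)) => [|S /andP[_ xS]]; last first.
    exact: setD1K.
  apply: eq_bigl => S; rewrite set_cons setU11 andbT; apply/andP/idP => [[sS /eqP defS]|sS].
    apply/subsetP => y; rewrite -defS in_setD1 => /andP[y_x yS].
    by have := subsetP sS y yS; rewrite in_setU1 (negPf y_x).
  by rewrite setUS // setU1K // xB.
apply: eq_bigl => S; rewrite set_cons; apply/andP/idP => [[sS xS]|sS].
  apply/subsetP => y yS; have := subsetP sS y yS; rewrite in_setU1 => /predU1P[yx|//].
  by rewrite -yx yS in xS.
by rewrite (subset_trans sS) ?subsetUr ?xB.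
Qed.

End SubseqSums.

(** * Polynomials and block embeddings *)

Section Polynomials.
Variable A : zmodType.

Definition supp (T : finType) (x : {ffun T -> 'F_2}) : {set T} := [set p | x p == 1].

(** On 0/1 values the monomial of [F] is the indicator of [F \subset supp x], so coefficients in an
    additive group suffice. With a strict bound, [d = 0] means the zero function, where the
    induction on the degree starts. *)
Definition deg_lt (d : nat) (T : finType) (f : {ffun T -> 'F_2} -> A) : Prop :=
  exists lam : {set T} -> A, forall x,
    f x = \sum_(F : {set T} | (#|F| < d)%N && (F \subset supp x)) lam F.

(** One notion for HJ-embeddings, for freezing some coordinates and for restricting to some
    coordinates. *)
Definition subst (T T' : finType) (s : T -> option T') (c : {ffun T -> 'F_2})
    (x : {ffun T' -> 'F_2}) : {ffun T -> 'F_2} :=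
  [ffun p => oapp x (c p) (s p)].

(** [pi F] is the monomial that [F] turns into under a change of variables; terms with equal [pi F]
    are collected. *)
Lemma deg_lt_regroup (d : nat) (T T' : finType) (pi : {set T} -> {set T'})
    (mu : {set T} -> A) (f : {ffun T' -> 'F_2} -> A) :
  (forall x, f x = \sum_(F : {set T} | pi F \subset supp x) mu F) ->
  (forall F, (d <= #|pi F|)%N -> mu F = 0) -> deg_lt d f.
Proof.
move=> fE mu0; exists (fun G => \sum_(F | pi F == G) mu F) => x.
rewrite fE (bigID (fun F => (#|pi F| < d)%N)) /= [X in _ + X]big1 ?addr0; last first.
  by move=> F /andP[_]; rewrite -leqNgt => /mu0.
rewrite (partition_big pi (fun G => (#|G| < d)%N && (G \subset supp x))) /=; last first.
  by move=> F; rewrite andbC.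
apply: eq_bigr => G /andP[dG Gx]; apply: eq_bigl => F.
by case: eqP => [->|_]; rewrite ?andbF // dG Gx.
Qed.

Section Subst.
Variables (T T' : finType) (s : T -> option T').

Definition simg (F : {set T}) : {set T'} := [set q | Some q \in s @: F].

(** A monomial survives the substitution exactly when its frozen variables all equal 1; it then
    becomes the monomial of [simg F]. *)
Definition subst_ok (c : {ffun T -> 'F_2}) : pred {set T} :=
  fun F => F \subset [set p | (s p == None) ==> (c p == 1)].

Lemma card_simg (F : {set T}) : (#|simg F| <= #|F|)%N.
Proof.
rewrite -(card_imset _ (@Some_inj _)) (leq_trans _ (leq_imset_card s F)) //.
by apply: subset_leq_card; apply/subsetP => _ /imsetP[q + ->]; rewrite inE.
Qed.

Lemma ltn_card_simg (F : {set T}) p : p \in F -> s p = None -> (#|simg F| < #|F|)%N.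
Proof.
move=> pF sp; rewrite (cardsD1 p F) pF ltnS (leq_trans _ (card_simg _)) //.
apply: subset_leq_card; apply/subsetP => q; rewrite !inE => /imsetP[r rF sr].
apply/imsetP; exists r => //; rewrite !inE rF andbT.
by apply: contra_eq_neq sr => ->; rewrite sp.
Qed.

Lemma supp_subst c x (F : {set T}) :
  (F \subset supp (subst s c x)) = subst_ok c F && (simg F \subset supp x).
Proof.
apply/subsetP/andP => [Fx|[/subsetP Fc /subsetP Fx] p pF].
  split; apply/subsetP => p; rewrite inE.
    by move=> /Fx; rewrite !inE ffunE; case: (s p).
  by case/imsetP=> r /Fx; rewrite !inE ffunE => + sr; rewrite -sr.
rewrite inE ffunE; case sp: (s p) => [q|] /=; last by have := Fc p pF; rewrite inE sp.
by have := Fx q; rewrite !inE; apply; apply/imsetP; exists p.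
Qed.

Lemma deg_lt_subst d f c : deg_lt d f -> deg_lt d (fun x => f (subst s c x)).
Proof.
case=> lam fE; apply: (@deg_lt_regroup _ _ _ simg
  (fun F => if (#|F| < d)%N && subst_ok c F then lam F else 0)) => [x|F dF].
  rewrite fE big_mkcond [RHS]big_mkcond; apply: eq_bigr => F _.
  by rewrite supp_subst andbA; case: ifP; case: (_ \subset _); rewrite ?andbT ?andbF // => ->.
by rewrite ltnNge (leq_trans dF (card_simg F)).
Qed.

(* Monomials supported on the substituted variables cancel, every other one
   loses at least one variable to the constants. *)
Lemma deg_lt_subst_diff d f c1 c2 :
  deg_lt d.+1 f -> deg_lt d (fun x => f (subst s c1 x) - f (subst s c2 x)).
Proof.
case=> lam fE; pose mu c (F : {set T}) := if (#|F| < d.+1)%N && subst_ok c F then lam F else 0.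
have fmu c x : f (subst s c x) = \sum_(F : {set T} | simg F \subset supp x) mu c F.
  rewrite fE big_mkcond [RHS]big_mkcond; apply: eq_bigr => F _.
  by rewrite supp_subst andbA /mu; case: ifP; case: (_ \subset supp x); rewrite ?andbT ?andbF // => ->.
apply: (@deg_lt_regroup _ _ _ simg (fun F => mu c1 F - mu c2 F)) => [x|F dF].
  by rewrite !fmu sumrB.
have [dom|] := boolP (F \subset [set p | s p != None]).
  suff okc c : subst_ok c F by rewrite /mu !okc subrr.
  by apply: subset_trans dom _; apply/subsetP => p; rewrite !inE; case: (s p).
case/subsetPn=> p pF; rewrite inE negbK => /eqP/(ltn_card_simg pF) ltF.
by rewrite /mu ltnNge (leq_trans _ ltF) // subrr.
Qed.
End Subst.

End Polynomials.

Lemma deg_lt_ffun (A : zmodType) (I T : finType) d (f : I -> {ffun T -> 'F_2} -> A) :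
  (forall i, deg_lt d (f i)) -> deg_lt d (fun x => [ffun i => f i x]).
Proof.
move=> /fin_all_exists[lam fE]; exists (fun F => [ffun i => lam i F]) => x.
apply/ffunP => i; rewrite ffunE sum_ffunE fE.
by apply: eq_bigr => F _; rewrite ffunE.
Qed.

Section Edges.

Fact edge_subproof n (u v : 'I_n) : (0 < #|[set u; v]|)%N && (#|[set u; v]| <= 2)%N.
Proof. by rewrite cards2; case: (u != v). Qed.

Definition edge n (u v : 'I_n) : Idx n := exist _ [set u; v] (edge_subproof u v).

Lemma edgeP n (p : Idx n) : exists u v, p = edge u v.
Proof.
case: p => S pS; case/andP: (pS); case cS: #|S| => [|[|[|]]] // _ _.
  have /cards1P[u Su] : #|S| == 1%N by rewrite cS.
  by exists u, u; apply: val_inj; rewrite /= setUid.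
have /cards2P[u [v [_ Su]]] : #|S| == 2%N by rewrite cS.
by exists u, v; apply: val_inj.
Qed.

(** The map on edges induced by a partial labelling of the vertices. The [insub] always succeeds, as
    one or two labelled vertices have one or two labels. *)
Definition pull n m (b : 'I_n -> option 'I_m) (p : Idx n) : option (Idx m) :=
  if None \in b @: val p then None
  else (insub [set i | Some i \in b @: val p] : option (Idx m)).

Lemma pull_edge n m (b : 'I_n -> option 'I_m) u v : pull b (edge u v) =
  if b u is Some i then if b v is Some j then Some (edge i j) else None else None.
Proof.
rewrite /pull /= imsetU !imset_set1 !inE ![None == _]eq_sym.
case: (b u) => [i|//]; case: (b v) => [j|//] /=.
set S := [set _ | _]; have defS : S = val (edge i j) by apply/setP=> k; rewrite !inE.
by rewrite defS valK.
Qed.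

Lemma pull_comp n m k (b : 'I_n -> option 'I_m) (b' : 'I_m -> option 'I_k) p :
  obind (pull b') (pull b p) = pull (fun v => obind b' (b v)) p.
Proof.
have [u [v ->]] := edgeP p; rewrite !pull_edge.
case: (b u) (b v) => [i|] [j|] //=; rewrite ?pull_edge //.
by case: (b' i).
Qed.

Lemma eq_in_pull n m (b b' : 'I_n -> option 'I_m) (p : Idx n) :
  {in val p, b =1 b'} -> pull b p = pull b' p.
Proof. by move=> eqb; rewrite /pull (eq_in_imset eqb). Qed.

Lemma pull_None n m (b : 'I_n -> option 'I_m) (p : Idx n) v :
  v \in val p -> b v = None -> pull b p = None.
Proof. by move=> vp bv; rewrite /pull -bv imset_f. Qed.

(** Wildcard sets encoded as the fibres of a partial labelling, so that disjointness is
    automatic. *)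
Definition block_label n m (b : 'I_n -> option 'I_m) : Prop :=
  (forall i, exists v, b v = Some i) /\
  (forall u v i j, b u = Some i -> b v = Some j -> (i < j)%N -> (u < v)%N).

(** Block HJ-embeddings in the form of substitutions, which makes composition and the effect on
    degrees transparent. Only the values of [c] at edges with an unlabelled end are read. *)
Definition HJ_map n m (e : points m -> points n) : Prop :=
  exists b c, block_label b /\ e =1 subst (pull b) c.

Lemma HJ_map_comp n m k (e : points m -> points n) (e' : points k -> points m) :
  HJ_map e -> HJ_map e' -> HJ_map (e \o e').
Proof.
move=> [b [c [[bS bM] eE]]] [b' [c' [[bS' bM'] eE']]].
exists (fun v => obind b' (b v)), (subst (pull b) c c'); split; first split.
- by move=> i; have [v bv] := bS' i; have [u bu] := bS v; exists u; rewrite bu.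
- move=> u v i j; case bu: (b u) => [s|] //; case bv: (b v) => [t|] //= bs bt lt_ij.
  exact: bM bu bv (bM' _ _ _ _ bs bt lt_ij).
move=> x; apply/ffunP => p; rewrite /= eE !ffunE -pull_comp.
by case: (pull b p) => [q|] //=; rewrite eE' ffunE; case: (pull b' q).
Qed.

Lemma HJ_map_inj n m (e : points m -> points n) : HJ_map e -> injective e.
Proof.
move=> [b [c [[bS _] eE]]] x y; rewrite !eE => exy; apply/ffunP => q.
have [i [j ->]] := edgeP q; have [u bu] := bS i; have [v bv] := bS j.
by have /ffunP/(_ (edge u v)) := exy; rewrite !ffunE pull_edge bu bv.
Qed.

Lemma deg_lt_HJ_map (A : zmodType) n m d (f : points n -> A) (e : points m -> points n) :
  HJ_map e -> deg_lt d f -> deg_lt d (f \o e).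
Proof.
move=> [b [c [_ eE]]] df; have [lam fE] := deg_lt_subst (pull b) c df.
by exists lam => x; rewrite /= eE fE.
Qed.

End Edges.

(** * Constancy on one subspace *)

(** Absorption gives [a * 'C(w, a) = w * 'C(w.-1, a.-1)] for [w] the upper index. As [a] divides the
    factorial of [D], the binomial is a multiple of [#|A|], which annihilates [A]. *)
Lemma mulrn_bin_card (A : finZmodType) (D a : nat) (y : A) :
  (0 < a <= D)%N -> y *+ 'C(#|A| * D`!, a) = 0.
Proof.
case: a => // a aD; have /dvdnP[q Dq] : (a.+1 %| D`!)%N by rewrite dvdn_fact.
have -> : 'C(#|A| * D`!, a.+1) = (#|A| * (q * 'C((#|A| * D`!).-1, a)))%N.
  apply/eqP; rewrite -(eqn_pmul2l (ltn0Sn a)) -mul_bin_diag Dq; apply/eqP.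
  by rewrite !mulnA mulnAC [(_ * a.+1)%N]mulnC !mulnA.
rewrite mulrnA; suff -> : y *+ #|A| = 0 by rewrite mul0rn.
by rewrite -FinRing.zmodXgE -cardsT expg_cardG ?inE.
Qed.

Section Homogeneous.
Variables (A : zmodType) (N m d : nat) (lam : {set Idx N} -> A).

Definition span (F : {set Idx N}) : {set 'I_N} := \bigcup_(p in F) val p.

Lemma card_span (F : {set Idx N}) : (#|span F| <= 2 * #|F|)%N.
Proof.
rewrite /span mulnC -sum_nat_const; elim/big_ind2: _ => [|S k S' k' Sk Sk'|p _].
- by rewrite cards0.
- by rewrite (leq_trans _ (leq_add Sk Sk')) // cardsU leq_subr.
by case: p => p /= /andP[].
Qed.

Lemma span_eq0 (F : {set Idx N}) : span F = set0 -> F = set0.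
Proof.
move=> F0; apply/setP => p; rewrite inE; apply: contraTF (valP p) => pF.
suff -> : val p = set0 by rewrite cards0.
by apply/eqP; rewrite -subset0 -F0 bigcup_sup.
Qed.

(** The part of the polynomial carried by monomials with vertex set exactly [S], at the image of [x]
    under the embedding labelled by [b]. Its constants are 0, so a set with an unlabelled vertex
    contributes nothing. *)
Definition mu (b : 'I_N -> option 'I_m) (x : points m) (S : {set 'I_N}) : A :=
  \sum_(F : {set Idx N} | [&& (#|F| < d)%N, span F == S &
                              F \subset supp (subst (pull b) 0 x)]) lam F.

Lemma eq_mu b b' x (S : {set 'I_N}) : {in S, b =1 b'} -> mu b x S = mu b' x S.
Proof.
move=> eqb; apply: eq_bigl => F; congr (_ && _).
case: eqP => //= SF.
have eqs p : p \in F -> (p \in supp (subst (pull b) 0 x)) = (p \in supp (subst (pull b') 0 x)).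
  move=> pF; rewrite !inE !ffunE (@eq_in_pull _ _ b b') // => v vp.
  by apply: eqb; rewrite -SF; apply/bigcupP; exists p.
by apply/subsetP/subsetP => sF p pF; have := sF p pF; rewrite eqs.
Qed.

Lemma mu_set0 b b' x x' : mu b x set0 = mu b' x' set0.
Proof.
apply: eq_bigl => F; congr (_ && _); case: eqP => //= /span_eq0->.
by rewrite !sub0set.
Qed.

Lemma mu_unlabelled b x (S : {set 'I_N}) v : v \in S -> b v = None -> mu b x S = 0.
Proof.
move=> vS bv; rewrite /mu big1 // => F /and3P[_ /eqP SF /subsetP sF].
move: vS; rewrite -SF => /bigcupP[p pF vp].
by have := sF p pF; rewrite inE ffunE (pull_None vp bv) /= ffunE.
Qed.

Lemma mu_large b x (S : {set 'I_N}) : (2 * d < #|S|)%N -> mu b x S = 0.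
Proof.
move=> dS; rewrite /mu big1 // => F /and3P[dF /eqP SF _].
have := leq_trans dS; rewrite -SF => /(_ _ (card_span F)).
by rewrite ltn_mul2l /= ltnNge (ltnW dF).
Qed.

Lemma sum_mu b x :
  \sum_(F : {set Idx N} | (#|F| < d)%N && (F \subset supp (subst (pull b) 0 x))) lam F =
  \sum_(S : {set 'I_N}) mu b x S.
Proof.
rewrite (partition_big span predT) //; apply: eq_bigr => S _.
by apply: eq_bigl => F; rewrite andbAC -andbA.
Qed.

Section Colouring.
Variables (D : nat) (i0 : 'I_m).

Definition seq_label (t : seq 'I_N) (l : D.-tuple 'I_m) (v : 'I_N) : option 'I_m :=
  if v \in t then Some (nth i0 l (index v t)) else None.

(** The colour records the contribution of the vertex set of [t] for all labellings of its vertices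
    and all [x]; on a homogeneous set the contribution thus depends on the label pattern only. The
    fixed length [D] of the tuples gives a single finite set of colours. *)
Definition colour (t : seq 'I_N) : {ffun D.-tuple 'I_m * points m -> A} :=
  [ffun lx => mu (seq_label t lx.1) lx.2 [set v in t]].

End Colouring.

End Homogeneous.

Lemma ramsey_deg_lt (A : finZmodType) (d m : nat) : (0 < m)%N ->
  exists N, forall f : points N -> A, deg_lt d f ->
  exists e : points m -> points N, HJ_map e /\ forall x y, f (e x) = f (e y).
Proof.
(* A monomial with fewer than [d] edges meets at most [D] vertices, and [w] is the block size for
   which [mulrn_bin_card] applies. *)
case: m => // m _; set D := (2 * d)%N; set w := (#|A| * D`!)%N.
have w_gt0 : (0 < w)%N by rewrite muln_gt0 fact_gt0 andbT; apply/card_gt0P; exists 0.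
have [N HN] := ramsey_le {ffun D.-tuple 'I_m.+1 * points m.+1 -> A} D (m.+1 * w).
exists N => f [lam fE].
have [|H [sH szH homH]] := HN _ (enum 'I_N) (colour d lam D ord0); first by rewrite size_enum_ord.
have uH : uniq H := subseq_uniq sH (enum_uniq _).
have ordH : sorted (fun u v : 'I_N => u < v)%N H.
  apply: (subseq_sorted _ sH); first by move=> ? ? ?; apply: ltn_trans.
  by rewrite -[sorted _ _]/(sorted (relpre (@nat_of_ord N) ltn) _) -sorted_map val_enum_ord iota_ltn_sorted.
pose lb v := (index v H %/ w)%N.
have lbm v : v \in H -> (lb v < m.+1)%N by rewrite -index_mem szH ltn_divLR.
pose b v : option 'I_m.+1 := if v \in H then Some (inord (lb v)) else None.
have bE u i : b u = Some i -> u \in H /\ lb u = i.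
  by rewrite /b; case: ifP => // uH' [<-]; rewrite inordK ?lbm.
exists (subst (pull b) 0); split.
  exists b, 0; split=> //; split=> [i|u v i j /bE[uH' ui] /bE[vH vj] lt_ij].
    have lt_i : (i * w < size H)%N by rewrite szH ltn_mul2r w_gt0 ltn_ord.
    have v0 : 'I_N by case: (H) lt_i => // v *.
    exists (nth v0 H (i * w)); rewrite /b mem_nth // /lb index_uniq //.
    by rewrite mulnK // inord_val.
  apply: (sorted_ltn_index _ ordH) => //; first by move=> ? ? ?; apply: ltn_trans.
  by rewrite ltnNge; apply/negP => /(leq_div2r w); rewrite -/(lb u) -/(lb v) ui vj leqNgt lt_ij.
pose pad (L : seq nat) : D.-tuple 'I_m.+1 := [tuple inord (nth 0%N L i) | i < D].
pose h x (L : seq nat) :=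
  if (size L <= D)%N then colour d lam D ord0 (take (size L) H) (pad L, x) else 0.
(* Only the empty vertex set survives, and its contribution is independent of [x]. *)
suff fh x : f (subst (pull b) 0 x) = h x [::].
  by move=> x y; rewrite !fh /h /= take0 !ffunE /= set_nil; apply: mu_set0.
rewrite fE sum_mu (bigID (fun S : {set 'I_N} => S \subset [set v in H])) /=.
rewrite [X in _ + X]big1 ?addr0 => [|S]; last first.
  case/subsetPn=> v vS; rewrite inE => vH.
  by apply: mu_unlabelled vS _; rewrite /b (negPf vH).
rewrite big_subsets_subseqs //.
transitivity (\sum_(t <- subseqs H) h x (map lb t)).
  apply: eq_big_seq => t /subseqs_subseq tH; rewrite /h size_map.
  case: leqP => tD; last first.
    by apply: mu_large; rewrite cardsE (card_uniqP (subseq_uniq tH uH)).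
  rewrite -(homH t) ?take_subseq // ?size_takel ?size_subseq // ffunE /=.
  apply: eq_mu => v; rewrite inE => vt.
  rewrite /b /seq_label (mem_subseq tH vt) vt; congr Some.
  have ltD : (index v t < D)%N by rewrite (leq_trans _ tD) // index_mem.
  rewrite -[index v t]/(val (Ordinal ltD)) -tnth_nth tnth_mktuple /=.
  by rewrite (nth_map v) ?index_mem // nth_index.
have -> : \sum_(t <- subseqs H) h x (map lb t) =
          \sum_(t <- subseqs [seq (j %/ w)%N | j <- iota 0 (m.+1 * w)]) h x t.
  rewrite -(big_map (map lb) xpredT (h x)) -subseqs_map; congr (\sum_(t <- subseqs _) _).
  rewrite -szH; apply: (@eq_from_nth _ 0%N); rewrite !size_map ?size_iota // => i lt_i.
  have v0 : 'I_N by case: (H) lt_i => // v *.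
  by rewrite (nth_map v0) // (nth_map 0%N) ?size_iota // nth_iota // /lb index_uniq.
apply: (@big_subseqs_blocks _ _ D) => [t Dt|a y aD]; first by rewrite /h leqNgt Dt.
exact: mulrn_bin_card.
Qed.

(** * Partial partitions *)

(** Makes [{ffun T -> A}] a finite abelian group, the value group of the bundled differences in the
    induction. *)
HB.instance Definition _ (T : finType) (A : finZmodType) :=
  GRing.Zmodule.on {ffun T -> A}.

Section Packing.
Variable R : realFieldType.

(** [r] bounds the number of uncovered points, not their proportion, so that losses add up over
    disjoint unions. *)
Definition packs (X : finType) (C : {set X} -> Prop) (S : {set X}) (r : R) : Prop :=
  exists Vs : {set {set X}}, [/\ trivIset Vs,
    forall V, V \in Vs -> C V /\ V \subset S & (#|S :\: cover Vs|)%:R <= r].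

Lemma packs_empty (X : finType) (C : {set X} -> Prop) (S : {set X}) r :
  (#|S|)%:R <= r -> packs C S r.
Proof.
move=> Sr; exists set0; split=> [|V|]; rewrite ?inE //.
  by apply/trivIsetP => V V'; rewrite inE.
by rewrite /cover big_set0 setD0.
Qed.

Lemma packs_self (X : finType) (C : {set X} -> Prop) (S : {set X}) : C S -> packs C S 0.
Proof.
move=> CS; exists [set S]; split=> [|V /set1P-> //|].
  by apply/trivIsetP => V V' /set1P-> /set1P->; rewrite eqxx.
by rewrite cover1 setDv cards0.
Qed.

Lemma packs_le (X : finType) (C : {set X} -> Prop) (S : {set X}) r r' :
  r <= r' -> packs C S r -> packs C S r'.
Proof. by move=> rr' [Vs [tVs CVs Sr]]; exists Vs; split=> //; apply: le_trans rr'. Qed.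

Lemma packs_bigcup (X J : finType) (P : pred J) (C : {set X} -> Prop)
    (S : J -> {set X}) (r : J -> R) :
  (forall i j x, P i -> P j -> x \in S i -> x \in S j -> i = j) ->
  (forall i, P i -> packs C (S i) (r i)) ->
  packs C (\bigcup_(i | P i) S i) (\sum_(i | P i) r i).
Proof.
move=> dS pS.
have /fin_all_exists[Vs HVs] : forall i, exists Vs : {set {set X}}, P i ->
    [/\ trivIset Vs, forall V, V \in Vs -> C V /\ V \subset S i &
        (#|S i :\: cover Vs|)%:R <= r i].
  move=> i; have [/pS[Vs HVs]|_] := boolP (P i); first by exists Vs.
  by exists set0.
exists (\bigcup_(i | P i) Vs i); split.
- apply/trivIsetP => V V' /bigcupP[i Pi Vi] /bigcupP[j Pj Vj] V_V'.
  have [/trivIsetP tV VS _] := HVs i Pi; have [_ VS' _] := HVs j Pj.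
  have [eij|/eqP nij] := eqVneq i j; first by apply: tV; rewrite // eij.
  apply/pred0P => x; apply/negP => /andP[xV xV']; apply: nij; apply: (dS i j x) => //.
    by have [_ /subsetP] := VS V Vi; apply.
  by have [_ /subsetP] := VS' V' Vj; apply.
- move=> V /bigcupP[i Pi /(let: And3 _ VS _ := HVs i Pi in VS V)[CV VS]].
  by split=> //; apply: subset_trans VS (bigcup_sup i Pi).
apply: le_trans (_ : (\sum_(i | P i) #|S i :\: cover (Vs i)|)%:R <= _); last first.
  by rewrite natr_sum; apply: ler_sum => i /HVs[].
rewrite ler_nat; have cardU : (#|\bigcup_(i | P i) (S i :\: cover (Vs i))|
    <= \sum_(i | P i) #|S i :\: cover (Vs i)|)%N.
  elim/big_ind2: _ => [|U k U' k' Uk Uk'|//]; first by rewrite cards0.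
  by rewrite (leq_trans _ (leq_add Uk Uk')) // cardsU leq_subr.
apply: leq_trans cardU; apply: subset_leq_card; apply/subsetP => x.
rewrite inE => /andP[xV /bigcupP[i Pi xi]]; apply/bigcupP; exists i => //.
rewrite inE xi andbT; apply: contra xV => /bigcupP[V Vi xV].
by apply/bigcupP; exists V => //; apply/bigcupP; exists i.
Qed.

Lemma packs_setU (X : finType) (C : {set X} -> Prop) (S S' : {set X}) r r' :
  [disjoint S & S'] -> packs C S r -> packs C S' r' -> packs C (S :|: S') (r + r').
Proof.
move=> /pred0P dS pS pS'.
have := @packs_bigcup X bool predT C (fun b => if b then S else S')
  (fun b => if b then r else r').
rewrite !big_bool; apply=> [|[] _ //].
have dSx x : x \in S -> x \in S' -> False by move=> xS xS'; have := dS x; rewrite /= xS xS'.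
by move=> [] [] x //= _ _ xi xj; have := dSx x; tauto.
Qed.

Lemma packs_imset (X X' : finType) (C : {set X} -> Prop) (C' : {set X'} -> Prop)
    (g : X' -> X) (S : {set X'}) r :
  injective g -> (forall V, C' V -> C (g @: V)) -> packs C' S r -> packs C (g @: S) r.
Proof.
move=> g_inj CC' [Vs [tVs CVs Sr]]; exists [set g @: (V : {set X'}) | V in Vs]; split.
- apply/trivIsetP => _ _ /imsetP[V VVs ->] /imsetP[V' VVs' ->] gV.
  have V_V' : V != V' by apply: contraNneq gV => ->.
  have /pred0P dV := trivIsetP tVs V V' VVs VVs' V_V'.
  apply/pred0P => x; apply/negP => /andP[/imsetP[y yV ->]].
  by case/imsetP=> y' yV' /g_inj yy'; have := dV y; rewrite /= yV yy' yV'.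
- move=> _ /imsetP[V /CVs[CV VS] ->]; split; [exact: CC' | exact: imsetS].
rewrite cover_imset -imset_cover; apply: le_trans Sr; rewrite ler_nat.
rewrite -(card_imset _ g_inj); apply: subset_leq_card; apply/subsetP => x.
rewrite inE => /andP[xV /imsetP[y yS xy]]; rewrite {x}xy in xV *.
by rewrite imset_f // inE yS andbT; apply: contra xV => /imset_f->.
Qed.

Definition const_HJ (A : zmodType) m n (f : points n -> A) (V : {set points n}) : Prop :=
  exists e : points m -> points n,
    [/\ HJ_map e, V = e @: setT & forall x y, f (e x) = f (e y)].

Definition packable (A : zmodType) m n (f : points n -> A) (u : R) : Prop :=
  packs (const_HJ m f) setT (u * #|points n|%:R).

Lemma packs_HJ_map (A : zmodType) k m n (f : points n -> A) (e : points m -> points n) u :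
  HJ_map e -> packable k (f \o e) u ->
  packs (const_HJ k f) (e @: setT) (u * #|points m|%:R).
Proof.
move=> eHJ; apply: packs_imset; first exact: HJ_map_inj.
move=> V [e' [eHJ' -> fc]]; exists (e \o e'); split=> //; first exact: HJ_map_comp.
by rewrite -imset_comp.
Qed.

End Packing.

(** * Splitting the vertices into two intervals *)

Section Split.
Variables n1 n2 : nat.
Local Notation n := (n1 + n2)%N.

Definition left_label (v : 'I_n) : option 'I_n1 :=
  if split v is inl i then Some i else None.
Definition right_label (v : 'I_n) : option 'I_n2 :=
  if split v is inr i then Some i else None.

Lemma left_labelE : (forall i, left_label (lshift n2 i) = Some i) *
                    (forall i, left_label (rshift n1 i) = None).
Proof.
split=> i; rewrite /left_label; first by rewrite -[lshift _ _]/(unsplit (inl i)) unsplitK.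
by rewrite -[rshift _ _]/(unsplit (inr i)) unsplitK.
Qed.

Lemma right_labelE : (forall i, right_label (lshift n2 i) = None) *
                     (forall i, right_label (rshift n1 i) = Some i).
Proof.
split=> i; rewrite /right_label; first by rewrite -[lshift _ _]/(unsplit (inl i)) unsplitK.
by rewrite -[rshift _ _]/(unsplit (inr i)) unsplitK.
Qed.

(** Edges on the left come from [a], edges on the right from [y], crossing edges from [z]; of the
    full point [z] only the crossing coordinates are read. *)
Definition comb (a : points n1) (z : points n) (y : points n2) : points n :=
  subst (pull left_label) (subst (pull right_label) z y) a.

Definition lpart (x : points n) : points n1 := subst (pull (Some \o lshift n2)) 0 x.
Definition rpart (x : points n) : points n2 := subst (pull (Some \o @rshift n1 n2)) 0 x.

Lemma combE a z y :
  (forall i j, comb a z y (edge (lshift n2 i) (lshift n2 j)) = a (edge i j)) *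
  (forall i j, comb a z y (edge (rshift n1 i) (rshift n1 j)) = y (edge i j)) *
  (forall i j, comb a z y (edge (lshift n2 i) (rshift n1 j)) =
               z (edge (lshift n2 i) (rshift n1 j))) *
  (forall i j, comb a z y (edge (rshift n1 j) (lshift n2 i)) =
               z (edge (rshift n1 j) (lshift n2 i))).
Proof. by do !split; move=> i j; rewrite !ffunE !pull_edge !left_labelE ?ffunE ?pull_edge ?right_labelE. Qed.

Lemma point_eqP (x y : points n) :
  (forall i j, x (edge (lshift n2 i) (lshift n2 j)) = y (edge (lshift n2 i) (lshift n2 j))) ->
  (forall i j, x (edge (rshift n1 i) (rshift n1 j)) = y (edge (rshift n1 i) (rshift n1 j))) ->
  (forall i j, x (edge (lshift n2 i) (rshift n1 j)) = y (edge (lshift n2 i) (rshift n1 j))) ->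
  (forall i j, x (edge (rshift n1 j) (lshift n2 i)) = y (edge (rshift n1 j) (lshift n2 i))) ->
  x = y.
Proof.
move=> ll rr lr rl; apply/ffunP => p; have [u [v ->]] := edgeP p.
by case: (split_ordP u) => i ->; case: (split_ordP v) => j ->.
Qed.

Lemma lpartE x i j : lpart x (edge i j) = x (edge (lshift n2 i) (lshift n2 j)).
Proof. by rewrite ffunE pull_edge. Qed.

Lemma rpartE x i j : rpart x (edge i j) = x (edge (rshift n1 i) (rshift n1 j)).
Proof. by rewrite ffunE pull_edge. Qed.

Lemma lpart_comb a z y : lpart (comb a z y) = a.
Proof. by apply/ffunP => p; have [u [v ->]] := edgeP p; rewrite lpartE combE. Qed.

Lemma rpart_comb a z y : rpart (comb a z y) = y.
Proof. by apply/ffunP => p; have [u [v ->]] := edgeP p; rewrite rpartE combE. Qed.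

Lemma comb_parts x : comb (lpart x) x (rpart x) = x.
Proof. by apply: point_eqP => i j; rewrite combE ?lpartE ?rpartE. Qed.

Lemma comb_comb a a' z y y' : comb a (comb a' z y') y = comb a z y.
Proof. by apply: point_eqP => i j; rewrite !combE. Qed.

(** Presents [comb] as a substitution in [y], the form needed for degrees and embeddings in that
    variable. *)
Lemma comb_swap a z y :
  comb a z y = subst (pull right_label) (subst (pull left_label) z a) y.
Proof.
by apply: point_eqP => i j; rewrite combE !ffunE !pull_edge !right_labelE ?ffunE ?pull_edge ?left_labelE.
Qed.

Lemma HJ_map_combl z y : HJ_map (fun a => comb a z y).
Proof.
exists left_label, (subst (pull right_label) z y); split=> //; split=> [i|u v i j].
  by exists (lshift n2 i); rewrite left_labelE.
case: (split_ordP u) => k ->; rewrite left_labelE // => -[<-].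
by case: (split_ordP v) => l ->; rewrite left_labelE // => -[<-].
Qed.

Lemma HJ_map_combr a z : HJ_map (comb a z).
Proof.
exists right_label, (subst (pull left_label) z a); split; last first.
  by move=> y; rewrite comb_swap.
split=> [i|u v i j]; first by exists (rshift n1 i); rewrite right_labelE.
case: (split_ordP u) => k ->; rewrite right_labelE // => -[<-].
by case: (split_ordP v) => l ->; rewrite right_labelE // => -[<-]; rewrite ltn_add2l.
Qed.

End Split.

(** * The packing *)

Section Step.
Variable R : realFieldType.
Variables (A : finZmodType) (m M N n : nat) (f : points (N + n) -> A).
Local Notation comb := (@comb N n).

(** The part over the image of [v] is covered without loss. This image is nonempty, so at most
    [#|points N| - 1] values of [a] remain, each losing a proportion [u]. *)
Lemma packs_cylinder z (e : points M -> points n) (v : points m -> points N) (u : R) :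
  0 <= u -> HJ_map e -> HJ_map v ->
  (forall a, packable m (f \o (comb a z \o e)) u) ->
  (forall y s t, f (comb (v s) z (e y)) = f (comb (v t) z (e y))) ->
  packs (const_HJ m f) [set comb a z (e y) | a in [set: points N], y in [set: points M]]
    ((#|points N|%:R - 1) * u * #|points M|%:R).
Proof.
move=> u0 eHJ vHJ pack_e f_v; pose V := v @: setT.
have e_inj := HJ_map_inj eHJ.
have comb_inj a a' y y' : comb a z (e y) = comb a' z (e y') -> a = a' /\ y = y'.
  move=> E; have := congr1 (@lpart N n) E; have := congr1 (@rpart N n) E.
  by rewrite !rpart_comb !lpart_comb => /e_inj.
have pV : packs (const_HJ m f) [set comb a z (e y) | a in V, y in [set: points M]] (0 : R).
  have -> : [set comb a z (e y) | a in V, y in [set: points M]] =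
      \bigcup_(y : points M) [set comb (v s) z (e y) | s in [set: points m]].
    apply/setP => x; apply/imset2P/bigcupP => [[a y /imsetP[s _ ->] _ ->]|[y _ /imsetP[s _ ->]]].
      by exists y => //; apply/imsetP; exists s.
    by exists (v s) y => //; apply/imsetP; exists s.
  apply: (@packs_le _ _ _ _ (\sum_(y : points M) 0)); first by rewrite big1.
  apply: packs_bigcup => [y y' x _ _ /imsetP[s _ ->] /imsetP[t _ /comb_inj[]] //|y _].
  apply: packs_self; exists ((fun a => comb a z (e y)) \o v); split=> //.
    exact: HJ_map_comp (HJ_map_combl _ _) vHJ.
  by move=> s t; apply: f_v.
have pVC : packs (const_HJ m f) [set comb a z (e y) | a in ~: V, y in [set: points M]]
    (\sum_(a in ~: V) u * #|points M|%:R).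
  have -> : [set comb a z (e y) | a in ~: V, y in [set: points M]] =
      \bigcup_(a in ~: V) [set comb a z (e y) | y in [set: points M]].
    apply/setP => x; apply/imset2P/bigcupP => [[a y aV _ ->]|[a aV /imsetP[y _ ->]]].
      by exists a => //; apply/imsetP; exists y.
    by exists a y.
  apply: packs_bigcup => [a a' x _ _ /imsetP[s _ ->] /imsetP[t _ /comb_inj[]] //|a _].
  exact: packs_HJ_map (HJ_map_comp (HJ_map_combr a z) eHJ) (pack_e a).
have := packs_setU _ pV pVC; rewrite add0r sumr_const => pU.
have -> : [set comb a z (e y) | a in [set: points N], y in [set: points M]] =
    [set comb a z (e y) | a in V, y in [set: points M]] :|:
    [set comb a z (e y) | a in ~: V, y in [set: points M]].
  apply/setP => x; rewrite in_setU; apply/imset2P/orP => [[a y _ _ ->]|].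
    have [aV|aV] := boolP (a \in V); [left|right]; apply/imset2P; exists a y => //.
    by rewrite inE.
  by case=> /imset2P[a y _ _ ->]; exists a y.
apply: packs_le (pU _); last first.
  apply/pred0P => x; apply/negP => /andP[/imset2P[a y aV _ ->] /imset2P[a' y' aV' _]].
  by case/comb_inj=> aa _; move: aV'; rewrite inE -aa aV.
rewrite -[X in X <= _]mulr_natl -mulrA ler_wpM2r ?mulr_ge0 //.
rewrite lerBrDr addrC -(cardsC V) natrD lerD2r ler1n card_gt0.
by apply/set0Pn; exists (v 0); apply: imset_f; rewrite inE.
Qed.

(** The proportion [eta] of the [y] missed by [packD] is given up; over each cell [W] of that
    packing, [packs_cylinder] loses the proportion [(1 - 1 / #|points N|) * u]. *)
Lemma packs_fibre d z (eta u : R) :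
  0 <= u -> 0 <= eta -> deg_lt d.+1 f ->
  (forall g : points N -> A, deg_lt d.+1 g ->
    exists e : points m -> points N, HJ_map e /\ forall x y, g (e x) = g (e y)) ->
  (forall g : points n -> {ffun points N -> A}, deg_lt d g -> packable M g eta) ->
  (forall g : points M -> A, deg_lt d.+1 g -> packable m g u) ->
  packs (const_HJ m f) [set comb a z y | a in [set: points N], y in [set: points n]]
    ((eta + (1 - (#|points N|%:R)^-1) * u) * (#|points N|%:R * #|points n|%:R)).
Proof.
move=> u0 eta0 df ram packD packf; set cN : R := #|points N|%:R.
have cN1 : 1 <= cN by rewrite ler1n; apply/card_gt0P; exists 0.
pose D y := [ffun a : points N => f (comb a z y) - f (comb 0 z y)].
have comb_inj a a' y y' : comb a z y = comb a' z y' -> a = a' /\ y = y'.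
  move=> E; have := congr1 (@lpart N n) E; have := congr1 (@rpart N n) E.
  by rewrite !rpart_comb !lpart_comb.
have [|Vs [tVs cVs leVs]] := packD D.
  apply: deg_lt_ffun => a.
  have [lam lamE] := deg_lt_subst_diff (pull (@right_label N n))
    (subst (pull (@left_label N n)) z a) (subst (pull (@left_label N n)) z 0) df.
  by exists lam => y; rewrite !comb_swap lamE.
have pW W : W \in Vs -> packs (const_HJ m f)
    [set comb a z y | a in [set: points N], y in W] ((cN - 1) * u * #|W|%:R).
  case/cVs=> [[e [eHJ -> De]] _].
  (* [v] is chosen for the single point [e 0] of [W]; constancy of the differences carries it to all
     other points. *)
  have [|v [vHJ fv]] := ram (fun a => f (comb a z (e 0))).
    exact: deg_lt_HJ_map (HJ_map_combl z (e 0)) df.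
  have -> : [set comb a z y | a in [set: points N], y in e @: setT] =
      [set comb a z (e y) | a in [set: points N], y in [set: points M]].
    apply/setP => x; apply/imset2P/imset2P => [[a _ _ /imsetP[y _ ->] ->]|[a y _ _ ->]].
      by exists a y; rewrite ?inE.
    by exists a (e y); rewrite ?imset_f ?inE.
  rewrite card_imset ?cardsT; last exact: HJ_map_inj.
  apply: (packs_cylinder u0 eHJ vHJ) => [a|y s t].
    by apply: packf; apply: deg_lt_HJ_map df; apply: HJ_map_comp (HJ_map_combr a z) eHJ.
  have /ffunP Dy := De y 0.
  have fE a : f (comb a z (e y)) =
      f (comb a z (e 0)) - f (comb 0 z (e 0)) + f (comb 0 z (e y)).
    by apply/eqP; rewrite -subr_eq; have := Dy a; rewrite !ffunE => ->.
  by rewrite (fE (v s)) (fE (v t)) (fv s t).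
have pU : packs (const_HJ m f)
    (\bigcup_(W in Vs) [set comb a z y | a in [set: points N], y in W])
    (\sum_(W in Vs) (cN - 1) * u * #|W|%:R).
  apply: packs_bigcup pW => W W' x WVs WVs'.
  case/imset2P=> a y _ yW -> /imset2P[a' y' _ yW' /comb_inj[_ yy']].
  apply/eqP; apply: contraT => /(trivIsetP tVs W W' WVs WVs')/pred0P/(_ y).
  by rewrite /= yW yy' yW'.
have pL : packs (const_HJ m f)
    [set comb a z y | a in [set: points N], y in ~: cover Vs] (cN * (eta * #|points n|%:R)).
  apply: packs_empty; apply: le_trans (_ : cN * #|~: cover Vs|%:R <= _); last first.
    by apply: ler_wpM2l; [exact: le_trans ler01 cN1 | rewrite -setTD; exact: leVs].
  have -> : [set comb a z y | a in [set: points N], y in ~: cover Vs] =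
      [set comb ay.1 z ay.2 | ay in setX setT (~: cover Vs)].
    apply/setP => x; apply/imset2P/imsetP => [[a y _ yV ->]|[[a y]]].
      by exists (a, y); rewrite // in_setX yV inE.
    by rewrite in_setX => /andP[_ yV] ->; exists a y.
  by rewrite /cN -natrM ler_nat (leq_trans (leq_imset_card _ _)) // cardsX cardsT.
have := packs_setU _ pL pU.
have -> : [set comb a z y | a in [set: points N], y in ~: cover Vs] :|:
    \bigcup_(W in Vs) [set comb a z y | a in [set: points N], y in W] =
    [set comb a z y | a in [set: points N], y in [set: points n]].
  apply/setP => x; rewrite in_setU; apply/orP/imset2P => [|[a y _ _ ->]].
    by case=> [|/bigcupP[W _]] /imset2P[a y _ _ ->]; exists a y.
  have [/bigcupP[W WVs yW]|yV] := boolP (y \in cover Vs); [right|left].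
    by apply/bigcupP; exists W => //; apply/imset2P; exists a y.
  by apply/imset2P; exists a y; rewrite ?inE.
move=> pLU; apply: packs_le (pLU _); last first.
  apply/pred0P => x; apply/negP => /andP[/imset2P[a y _ yV ->] /bigcupP[W WVs]].
  case/imset2P=> a' y' _ yW /comb_inj[_ yy']; move: yV; rewrite inE yy'.
  by case/negP; apply/bigcupP; exists W.
rewrite -mulr_sumr -natr_sum (eqP (tVs : _ == _)).
have leV : #|cover Vs|%:R <= #|points n|%:R :> R by rewrite ler_nat max_card.
have -> : (eta + (1 - cN^-1) * u) * (cN * #|points n|%:R) =
    cN * (eta * #|points n|%:R) + (cN - 1) * u * #|points n|%:R.
  by field; apply: lt0r_neq0; apply: lt_le_trans cN1.
by rewrite lerD2l ler_wpM2l // mulr_ge0 // subr_ge0.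
Qed.

End Step.

Section Packability.
Variable R : realType.

Lemma packable_step (A : finZmodType) (m M N n d : nat) (eta u : R) :
  0 <= u -> 0 <= eta ->
  (forall g : points N -> A, deg_lt d.+1 g ->
    exists e : points m -> points N, HJ_map e /\ forall x y, g (e x) = g (e y)) ->
  (forall g : points n -> {ffun points N -> A}, deg_lt d g -> packable M g eta) ->
  (forall g : points M -> A, deg_lt d.+1 g -> packable m g u) ->
  forall f : points (N + n) -> A, deg_lt d.+1 f ->
  packable m f (eta + (1 - (#|points N|%:R)^-1) * u).
Proof.
move=> u0 eta0 ram packD packf f df; set r := eta + _.
have r0 : 0 <= r.
  rewrite addr_ge0 // mulr_ge0 // subr_ge0 invf_le1 ?ler1n ?ltr0n;
  by apply/card_gt0P; exists 0.
(* Representatives of the crossing data: the points vanishing on all edges that do not cross. *)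
pose Z := [set z : points (N + n) | comb 0 z 0 == z].
have pZ := packs_bigcup (P := mem Z) _ (fun z _ => packs_fibre z u0 eta0 df ram packD packf).
rewrite /packable.
have -> : setT = \bigcup_(z in Z) [set comb a z y | a in [set: points N], y in [set: points n]].
  apply/setP => x; rewrite inE; apply/esym/bigcupP; exists (comb 0 x 0).
    by rewrite inE comb_comb.
  by apply/imset2P; exists (lpart x) (rpart x); rewrite ?inE // comb_comb comb_parts.
apply: packs_le (pZ _) => [|z z' x]; last first.
  rewrite !inE => /eqP zE /eqP zE' /imset2P[a y _ _ ->] /imset2P[a' y' _ _ E].
  by rewrite -zE -(comb_comb 0 a z 0 y) E comb_comb zE'.
(* The map from triples [(z, a, y)] with [z] in [Z] to [comb a z y] is injective, so the fibres have
   total size at most that of the space. *)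
rewrite sumr_const -[X in X <= _]mulr_natl [X in X <= _]mulrCA ler_wpM2l // -!natrM ler_nat.
have <- : #|(fun t => comb t.2.1 t.1 t.2.2) @: setX Z (setX [set: points N] [set: points n])| =
    (#|Z| * (#|points N| * #|points n|))%N; last exact: max_card.
rewrite card_in_imset ?cardsX ?cardsT //.
move=> [z [a y]] [z' [a' y']]; rewrite !in_setX !inE /= !andbT => /eqP zE /eqP zE' E.
have := congr1 (@lpart N n) E; have := congr1 (@rpart N n) E.
rewrite !rpart_comb !lpart_comb => -> ->; congr (_, _).
by rewrite -zE -(comb_comb 0 a z 0 y) E comb_comb zE'.
Qed.

(** The function is zero, so fixing every edge outside the first [m] vertices cuts the space exactly
    into suitable cells. *)
Lemma packable_deg_lt0 (A : zmodType) (m n : nat) (f : points (m + n) -> A) :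
  deg_lt 0 f -> packable m f (0 : R).
Proof.
case=> lam fE; have f0 x : f x = 0 by rewrite fE big_pred0.
rewrite /packable mul0r.
have -> : setT = \bigcup_(z : points (m + n) | comb 0 z (rpart z) == z)
    (fun a => comb a z (rpart z)) @: [set: points m].
  apply/setP => x; rewrite inE; apply/esym/bigcupP; exists (comb 0 x (rpart x)).
    by rewrite comb_comb rpart_comb.
  by apply/imsetP; exists (lpart x); rewrite ?inE // comb_comb rpart_comb comb_parts.
apply: (@packs_le _ _ _ _ (\sum_(z : points (m + n) | comb 0 z (rpart z) == z) 0)).
  by rewrite big1.
apply: packs_bigcup => [z z' x /eqP zE /eqP zE'|z _].
  move=> /imsetP[a _ ->] /imsetP[a' _ E].
  have := congr1 (@rpart m n) E; rewrite !rpart_comb => rE.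
  by rewrite -zE -(comb_comb 0 a z _ (rpart z)) E comb_comb rE zE'.
apply: packs_self; exists (fun a => comb a z (rpart z)); split=> // [|x y].
  exact: HJ_map_combl.
by rewrite !f0.
Qed.

(** The induction on [d] varies [A], [m] and [eta]: it is used for values in [{ffun points N -> A}],
    dimension [M.+1] and error [gamma]. *)
Lemma packable_deg_lt (d : nat) (A : finZmodType) (m : nat) (eta : R) :
  (0 < m)%N -> 0 < eta -> exists n0, forall n, (n0 <= n)%N ->
  forall f : points n -> A, deg_lt d f -> packable m f eta.
Proof.
elim: d A m eta => [|d IHd] A m eta m0 eta0.
  exists m => n le_n; rewrite -(subnKC le_n) => f df.
  by apply: packs_le (packable_deg_lt0 df); rewrite mul0r mulr_ge0 // ltW.
have [N ram] := ramsey_deg_lt A d.+1 m0.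
have cN1 : 1 <= #|points N|%:R :> R by rewrite ler1n; apply/card_gt0P; exists 0.
set delta : R := (#|points N|%:R)^-1.
have delta0 : 0 < delta by rewrite invr_gt0 (lt_le_trans ltr01).
have delta1 : delta <= 1 by rewrite invf_le1 // (lt_le_trans ltr01).
(* A round turns [u] into [gamma + (1 - delta) * u]. While [u >= eta], [delta * u >= 2 * gamma], so
   the round gains at least [gamma]. *)
pose gamma := delta * eta / 2.
have gamma0 : 0 < gamma by rewrite !mulr_gt0 // invr_gt0 ltr0n.
have iter_t (t : nat) : exists n0, forall n, (n0 <= n)%N -> forall f : points n -> A,
    deg_lt d.+1 f -> packable m f (Num.max eta (1 - t%:R * gamma)).
  elim: t => [|t [M IHt]].
    exists 0%N => n _ f _; apply: packs_empty; rewrite cardsT ler_peMl //.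
    by rewrite mul0r subr0 le_max lexx orbT.
  (* The dimension [M] reached by the previous rounds is known before [n1] is chosen; [M.+1] makes
     it positive. *)
  have [n1 Hn1] := IHd {ffun points N -> A} M.+1 gamma isT gamma0.
  exists (N + n1)%N => n le_n.
  have le_N : (N <= n)%N by apply: leq_trans le_n; apply: leq_addr.
  rewrite -(subnKC le_N) => f df; set u := Num.max eta (1 - t%:R * gamma) in IHt.
  have u0 : eta <= u by rewrite le_max lexx.
  have n1_le : (n1 <= n - N)%N by rewrite leq_subRL.
  have := packable_step (le_trans (ltW eta0) u0) (ltW gamma0) ram (Hn1 _ n1_le) (IHt M.+1 (leqnSn M)) df.
  apply: packs_le.
  rewrite ler_wpM2r // -/delta.
  have gE : gamma * 2 = delta * eta by rewrite /gamma mulfVK // pnatr_eq0.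
  have le_u : gamma * 2 <= delta * u by rewrite gE ler_wpM2l // ltW.
  have : u <= Num.max eta (1 - t.+1%:R * gamma) + gamma.
    by rewrite ge_max -natr1 !addr_maxl !le_max; apply/andP; split; apply/orP; [left|right]; nra.
  by nra.
have [t Ht] : exists t : nat, 1 <= t%:R * gamma.
  exists (Num.bound (gamma^-1)); rewrite -ler_pdivrMr // mul1r.
  by rewrite ltW // archi_boundP // invr_ge0 ltW.
have [n0 Hn0] := iter_t t; exists n0 => n le_n f /(Hn0 n le_n f).
by rewrite max_l // (le_trans _ (ltW eta0)) // subr_le0.
Qed.

End Packability.

(** * Translation to wildcard sets and integer polynomials *)

Lemma HJ_map_embedding n m (e : points m -> points n) : HJ_map e ->
  exists (I : 'I_m -> {set 'I_n}) (c : points n),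
    [/\ block_wildcards I, c_admissible I c & e =1 HJ_embedding I c].
Proof.
move=> [b [c [[bS bM] eE]]]; pose I (i : 'I_m) : {set 'I_n} := [set v | b v == Some i].
have IP i v : reflect (b v = Some i) (v \in I i) by rewrite inE; apply: eqP.
have minP i v : v \in I i -> (smin (I i) <= v)%N.
  move=> vi; rewrite /smin; have := mem_index_enum v.
  elim: (index_enum _) => // w s IHs; rewrite big_cons inE => /predU1P[<-|/IHs le_v].
    by rewrite vi geq_minl.
  by case: ifP; rewrite // geq_min le_v orbT.
(* The default value [n] of [smin] exceeds every vertex. *)
have min_in j (v : 'I_n) : (forall u, u \in I j -> (v < u)%N) -> (v < smin (I j))%N.
  by move=> ltv; rewrite /smin; elim/big_ind: _ => // x y vx vy; rewrite leq_min vx.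
have blockI (i j : 'I_m) : (i < j)%N -> (smax (I i) < smin (I j))%N.
  move=> lt_ij; have [v bv] := bS i.
  have lt_v u : u \in I i -> (u < smin (I j))%N.
    by move=> /IP bu; apply: min_in => // w /IP bw; apply: bM bu bw lt_ij.
  (* The maximum in [smax] starts from 0, so 0 must lie below [smin (I j)] too. *)
  have : (0 < smin (I j))%N by apply: leq_trans (lt_v v _); rewrite // inE bv.
  rewrite /smax => s0; elim/big_ind: _ => // x y xs ys.
  by rewrite gtn_max xs.
(* On edges inside the union both ends are labelled and the substitution never reads [c], so it may
   be set to 0 there. *)
exists I, [ffun p : Idx n => if val p \subset wunion I then 0 else c p]; split.
- split=> //; split=> [i|]; first by have [v bv] := bS i; apply/set0Pn; exists v; apply/IP.
  split=> [i j|i j lt_ij].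
    rewrite -setI_eq0; apply: contraNT => /set0Pn[v]; rewrite inE => /andP[/IP bv /IP].
    by rewrite bv => -[->].
  have [v bv] := bS i; apply: leq_ltn_trans (blockI i j lt_ij).
  apply: leq_trans (minP i v _) _; first exact/IP.
  by rewrite /smax (bigD1 v) ?inE ?bv //= leq_maxl.
- by move=> p pI; rewrite ffunE pI.
move=> x; apply/ffunP => p; rewrite eE !ffunE.
have [u [v ->]] := edgeP p; rewrite pull_edge.
have inU w : (w \in wunion I) = (b w != None).
  apply/bigcupP/idP => [[i _ /IP->] //|]; case bw: (b w) => [i|] // _.
  by exists i => //; apply/IP.
have -> : (val (edge u v) \subset wunion I) = (b u != None) && (b v != None).
  by rewrite /= subUset !sub1set !inU.
case bu: (b u) => [i|] /=; last first.
  rewrite big1 ?add0r // => q _; rewrite ffunE ifF ?mulr0 //.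
  apply/negP => /andP[/subsetP/(_ u)]; rewrite in_set2 eqxx => /(_ isT)/bigcupP[i _ /IP].
  by rewrite bu.
case bv: (b v) => [j|] /=; last first.
  rewrite big1 ?add0r // => q _; rewrite ffunE ifF ?mulr0 //.
  apply/negP => /andP[/subsetP/(_ v)]; rewrite in_set2 eqxx orbT => /(_ isT)/bigcupP[i' _ /IP].
  by rewrite bv.
(* Only [q = {i, j}] contributes: meeting [I k] for all [k] in [q] forces [q] into [{i, j}], and
   covering [u] and [v] forces equality. *)
rewrite addr0 (bigD1 (edge i j)) //= big1 ?addr0 => [|q]; rewrite ffunE.
  rewrite ifT ?mulr1 //; apply/andP; split.
    rewrite subUset !sub1set; apply/andP; split; apply/bigcupP.
      by exists i; rewrite ?in_set2 ?eqxx //; apply/IP.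
    by exists j; rewrite ?in_set2 ?eqxx ?orbT //; apply/IP.
  apply/forall_inP => k; rewrite in_set2 => /orP[]/eqP->; apply/set0Pn.
    by exists u; rewrite inE in_set2 eqxx; apply/IP.
  by exists v; rewrite inE in_set2 eqxx orbT; apply/IP.
move=> q_ij; rewrite ifF ?mulr0 //; apply: contraNF q_ij => /andP[/subsetP pq /forall_inP qp].
apply/eqP/val_inj/setP => k; rewrite in_set2; apply/idP/orP => [/qp/set0Pn[w]|].
  rewrite inE in_set2 => /andP[/orP[]/eqP-> /IP]; rewrite ?bu ?bv => -[->]; rewrite eqxx; auto.
have /bigcupP[i' iq /IP] : u \in \bigcup_(i in val q) I i by apply: pq; rewrite in_set2 eqxx.
have /bigcupP[j' jq /IP] : v \in \bigcup_(i in val q) I i.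
  by apply: pq; rewrite in_set2 eqxx orbT.
by rewrite bu bv => -[->] [->] []/eqP->.
Qed.

(** [alpha] becomes the coefficient of the empty monomial, and a product of 0/1 values is the
    indicator of [F \subset supp x]. *)
Lemma int_poly_deg_lt n d (Q : points n -> 'Z_(2 ^ d)) : is_int_poly d Q -> deg_lt d.+1 Q.
Proof.
case=> alpha [lam QE].
exists (fun F : {set Idx n} => if F == set0 then alpha else lam F) => x.
rewrite QE [RHS](bigD1 set0) /=; last by rewrite cards0 sub0set.
rewrite eqxx; congr (_ + _).
rewrite big_mkcond [RHS]big_mkcond; apply: eq_bigr => F _.
rewrite card_gt0 ltnS; have [->|F0] := eqVneq F set0; first by rewrite !andbF.
rewrite andbT /=; case: (#|F| <= d)%N => //=; case: ifP => [/subsetP Fx|/negbT/subsetPn[p pF]].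
  rewrite big1 ?mulr1 // => p /Fx; rewrite inE => /eqP->.
  by rewrite /lift01.
rewrite inE (bigD1 p) //= => xp; suff -> : x p = 0 by rewrite /lift01 mul0r mulr0.
by case: (x p) xp => [[|[|//]] // ?] xp; apply: val_inj => //; case/eqP: xp; apply: val_inj.
Qed.

Unset Implicit Arguments.

Theorem theorem5p5 (R : realType) (eta : R) (m d : nat) :
  0 < eta -> (0 < m)%N -> (0 < d)%N ->
  exists n3 : nat, (0 < n3)%N /\
    forall n : nat, (n3 <= n)%N ->
    forall Q : points n -> 'Z_(2 ^ d), is_int_poly d Q ->
    exists Vs : {set {set points n}},
      trivIset Vs /\
      (forall V, V \in Vs -> block_HJ_subspace m V) /\
      prob (~: cover Vs) <= eta /\
      (forall V, V \in Vs -> forall x y, x \in V -> y \in V -> Q x = Q y).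
Proof.
move=> eta0 m0 _.
have [n0 Hn0] := packable_deg_lt d.+1 'Z_(2 ^ d) m0 eta0.
exists n0.+1; split=> // n /ltnW le_n Q /int_poly_deg_lt dQ.
have [Vs [tVs cVs leVs]] := Hn0 n le_n Q dQ; exists Vs; split=> //; split=> [V|].
  case/cVs=> [[e [/HJ_map_embedding[I [c [bI aI eE]]] -> _]] _].
  exists I, c; do !split=> //; apply/setP => y.
  by apply/imsetP/imsetP => -[x _ ->]; exists x; rewrite ?inE ?eE.
split=> [|V /cVs[[e [_ -> Qe]] _] _ _ /imsetP[x _ ->] /imsetP[y _ ->] //].
rewrite /prob ler_pdivrMr; first by rewrite -setTD.
by rewrite ltr0n; apply/card_gt0P; exists 0.
Qed.
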